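(* Let $m\ge 2$ be an integer and let $\varphi$ denote Euler's totient function. Then $$|\Lambda(m)/\mathfrak{D}_m|=\frac{1}{2m}\Bigl(\sum_{2\le d\mid m}\varphi(m/d)A(d)+\frac{1+(-1)^m}{2}\cdot 3\cdot 2^{m/2}\cdot\frac{m}{2}\Bigr),$$ where the sum runs over the divisors $d\geq 2$ of $m$.
   Context: For an integer $m\ge 2$, $S(m)$ is the unit circle in $\mathbb{C}$ with the $m$ vertices $e^{2\pi i k/m}$ $(k=0,1,\dots,m-1)$, which divide it into $m$ arcs. A coloring on $S(m)$ is an assignment of one of three fixed colors to each arc such that any two adjacent arcs (arcs sharing a vertex) have different colors. $\Lambda(m)$ is the set of all colorings on $S(m)$ and $A(m):=|\Lambda(m)|$. $\mathfrak{D}_m$ is the dihedral group of order $2m$ consisting of the $m$ rotations of $\mathbb{C}$ by angles $2\pi k/m$ and the $m$ reflections in the lines obtained by rotating the real axis by angles $\pi k/m$ $(k=0,\dots,m-1)$. It preserves the vertices of $S(m)$ and hence acts on the arcs and on $\Lambda(m)$; $\Lambda(m)/\mathfrak{D}_m$ is the set of orbits. *)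

(* Defs.v *)
From mathcomp Require Import all_boot all_order all_algebra.
From mathcomp Require Import complex.
From mathcomp Require Import all_classical all_reals all_analysis.

Set Implicit Arguments.
Unset Strict Implicit.
Unset Printing Implicit Defensive.

Import Order.TTheory GRing.Theory Num.Theory.
Import numFieldNormedType.Exports.
Local Open Scope classical_set_scope.
Local Open Scope ring_scope.

(* e^{i t} *)
Definition cis (R : realType) (t : R) : R[i] := Complex (cos t) (sin t).

Definition vertex (R : realType) (m k : nat) : R[i] :=
  cis (2 * pi * k%:R / m%:R).

(* The closed arc of the unit circle from [vertex m k] to [vertex m k.+1];
   the [m] arcs are those with [k < m]. *)
Definition arc (R : realType) (m k : nat) : set R[i] :=
  [set cis t | t in [set t : R |
    2 * pi * k%:R / m%:R <= t <= 2 * pi * k.+1%:R / m%:R]].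

Arguments arc : clear implicits.
Arguments vertex : clear implicits.

Definition adjacent (R : realType) (m : nat) (i j : 'I_m) : Prop :=
  i <> j /\
  exists k : 'I_m, arc R m i (vertex R m k) /\ arc R m j (vertex R m k).

Arguments adjacent : clear implicits.

Definition Lambda (R : realType) (m : nat) : {set {ffun 'I_m -> 'I_3}} :=
  [set c : {ffun 'I_m -> 'I_3} |
    [forall i, forall j, `[< adjacent R m i j >] ==> (c i != c j)]]%SET.

Arguments Lambda : clear implicits.

Definition A (R : realType) (m : nat) : nat := #|Lambda R m|.

Arguments A : clear implicits.

Definition rotation (R : realType) (t : R) (z : R[i]) : R[i] := cis t * z.

(* Reflection in the line obtained by rotating the real axis by [t]. *)
Definition reflection (R : realType) (t : R) (z : R[i]) : R[i] :=
  rotation t (conjc (rotation (- t) z)).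

Definition dihedral (R : realType) (m : nat) : set (R[i] -> R[i]) :=
  [set g | (exists k : 'I_m, g = rotation (2 * pi * k%:R / m%:R)) \/
           (exists k : 'I_m, g = reflection (pi * k%:R / m%:R))].

Arguments dihedral : clear implicits.

(* [c' = g . c]: the arc [g a] has in [c'] the color that [a] has in [c]. *)
Definition is_image (R : realType) (m : nat) (g : R[i] -> R[i])
    (c c' : {ffun 'I_m -> 'I_3}) : Prop :=
  forall i j : 'I_m, g @` arc R m i = arc R m j -> c' j = c i.

Definition dihedral_orbit (R : realType) (m : nat)
    (c : {ffun 'I_m -> 'I_3}) : {set {ffun 'I_m -> 'I_3}} :=
  [set c' in Lambda R m |
    `[< exists2 g, dihedral R m g & is_image g c c' >]]%SET.

Arguments dihedral_orbit : clear implicits.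

Definition orbits (R : realType) (m : nat) : {set {set {ffun 'I_m -> 'I_3}}} :=
  [set dihedral_orbit R m c | c in Lambda R m]%SET.

Arguments orbits : clear implicits.

(* Main.v *)
(* Arc [i] is sent to arc [i + k] by the rotations and to arc [k - 1 - i] by the
   reflections, so the orbits can be counted by Burnside's lemma for the affine
   maps [i |-> k + i] and [i |-> l - i] of Z/m. This group has order [2 * m] even
   for [m = 2], where it does not act faithfully on the arcs. A coloring fixed by
   the rotation [k] is a coloring with period [d = gcd (m, k)], i.e. a coloring of
   the [d]-gon (none if [d = 1]), and [phi (m / d)] of the [k] give a prescribed
   [d]. The reflection [l] exchanges two adjacent arcs, hence fixes no coloring,
   unless [m] and [l] are even; it then fixes [3 * 2 ^ (m / 2)] colorings, and
   there are [m / 2] such [l]. *)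
Require Import Defs.
From HB Require Import structures.
From mathcomp Require Import all_boot all_order all_algebra all_fingroup.
From mathcomp Require Import complex.
From mathcomp Require Import all_classical all_reals all_analysis.
From mathcomp Require Import ring lra zify.
(* Otherwise [arc] would denote the operation on cycles of [path]. *)
Import Defs.

Set Implicit Arguments.
Unset Strict Implicit.
Unset Printing Implicit Defensive.

Import Order.TTheory GRing.Theory Num.Theory.
Local Open Scope classical_set_scope.
Local Open Scope ring_scope.

(** * Angles and arcs *)

Lemma cisD (R : realType) (s t : R) : cis (s + t) = cis s * cis t.
Proof. by rewrite /cis cosD sinD; congr Complex; rewrite addrC [cos s * _]mulrC. Qed.

Lemma conjc_cis (R : realType) (t : R) : conjc (cis t) = cis (- t).
Proof. by rewrite /cis cosN sinN. Qed.

Lemma cis2pi (R : realType) : cis (2 * pi) = 1 :> R[i].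
Proof. by rewrite /cis mulr_natl cos2pi sin2pi. Qed.

Lemma reflection_cis (R : realType) (t s : R) :
  reflection t (cis s) = cis (2 * t - s).
Proof.
by rewrite /reflection /rotation -cisD conjc_cis -cisD; congr cis; ring.
Qed.

(** The difference [u] of the angles has [cos u = 1], hence [sin (u / 2) = 0], which is impossible
    for [0 < u < 2 * pi]. *)
Lemma cis_inj_bounded (R : realType) (s t : R) :
  cis s = cis t -> `|s - t| <= 2 * pi ->
  [\/ s = t, s = t + 2 * pi | s = t - 2 * pi].
Proof.
case=> ec es; have cst : cos (s - t) = 1.
  by rewrite cosB ec es -!expr2 cos2Dsin2.
have sin0 (u : R) : cos u = 1 -> sin (u / 2) = 0.
  move=> cu; apply/eqP; rewrite -sqrf_eq0 sin2cos2; apply/eqP.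
  have := cos_mulr2n (u / 2); have -> : u / 2 *+ 2 = u by rewrite mulr2n; lra.
  by rewrite cu mulr2n => ?; lra.
have nointerior (u : R) : cos u = 1 -> 0 < u -> u < 2 * pi -> False.
  move=> /sin0 su u0 u2; suff : 0 < sin (u / 2) by rewrite su ltxx.
  by apply: sin_gt0_pi; apply/andP; split; lra.
rewrite ler_norml => /andP[l1 l2].
have [->|/eqP ne] := eqVneq s t; first by constructor 1.
have [lst|lts|//] := ltrgtP s t.
- have [->|/eqP ne2] := eqVneq s (t - 2 * pi); first by constructor 3.
  case: (nointerior (t - s)); last 2 first.
  + by lra.
  + rewrite lt_neqAle; apply/andP; split; last by lra.
    by apply/eqP => h; apply: ne2; lra.
  by rewrite -cosN opprB.
- have [->|/eqP ne2] := eqVneq s (t + 2 * pi); first by constructor 2.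
  case: (nointerior (s - t)) => //; first by lra.
  rewrite lt_neqAle; apply/andP; split; last by lra.
  by apply/eqP => h; apply: ne2; lra.
Qed.

(* Angles are measured in half-arcs [pi / m], so that both the vertices (even
   multiples) and the midpoints of the arcs (odd multiples) are integral. *)
Definition half_arc (R : realType) (m n : nat) : R :=
  n%:R * (pi / m%:R).

Lemma arcE (R : realType) (m j : nat) : arc R m j =
  @cis R @` [set t | half_arc R m (2 * j) <= t <= half_arc R m (2 * j).+2].
Proof.
have e k : 2 * pi * k%:R / m%:R = half_arc R m (2 * k).
  by rewrite /half_arc natrM; ring.
by rewrite /arc !e mulnS.
Qed.

Lemma vertexE (R : realType) (m k : nat) :
  vertex R m k = cis (half_arc R m (2 * k)).
Proof. by rewrite /vertex; congr cis; rewrite /half_arc natrM; ring. Qed.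

Lemma half_arc_full (R : realType) (m : nat) : (0 < m)%N ->
  half_arc R m (2 * m) = 2 * pi.
Proof.
by move=> m0; rewrite /half_arc natrM; field; rewrite pnatr_eq0 -lt0n.
Qed.

Lemma half_arcD (R : realType) (m p q : nat) :
  half_arc R m (p + q) = half_arc R m p + half_arc R m q.
Proof. by rewrite /half_arc natrD mulrDl. Qed.

Lemma half_arc_le (R : realType) (m p q : nat) : (0 < m)%N ->
  (half_arc R m p <= half_arc R m q) = (p <= q)%N.
Proof.
move=> m0; rewrite /half_arc ler_pM2r ?ler_nat//.
by rewrite divr_gt0 ?pi_gt0 ?ltr0n.
Qed.

Lemma half_arc_ge0 (R : realType) (m p : nat) : 0 <= half_arc R m p.
Proof. by rewrite /half_arc mulr_ge0// divr_ge0// pi_ge0. Qed.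

(** The second alternative is the point 1, at angle 0, met as the end of the last arc, at angle
    [2 * pi]. *)
Lemma mem_arc (R : realType) (m n j : nat) : (n < 2 * m)%N -> (j < m)%N ->
  arc R m j (cis (half_arc R m n)) ->
  (2 * j <= n <= (2 * j).+2)%N \/ (n = 0 /\ j.+1 = m)%N.
Proof.
move=> nm jm; have m0 : (0 < m)%N by lia.
rewrite arcE => -[t /= /andP[t1 t2]] e.
have full := half_arc_full R m0.
have n1 : half_arc R m n <= half_arc R m (2 * m) by rewrite half_arc_le// ltnW.
have n2 := half_arc_ge0 R m n; have j1 := half_arc_ge0 R m (2 * j).
have j2 : half_arc R m (2 * j).+2 <= half_arc R m (2 * m).
  by rewrite half_arc_le//; lia.
have [||h|h] := cis_inj_bounded e.
- by rewrite ler_norml; apply/andP; split; lra.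
- by move=> h; left; rewrite -!(half_arc_le R _ _ m0) -h t1 t2.
- right; have : (half_arc R m (n + 2 * m) <= half_arc R m (2 * j).+2).
    by rewrite half_arcD full -h.
  by rewrite half_arc_le//; lia.
- have : (half_arc R m (2 * m) <= half_arc R m n).
    by rewrite full; lra.
  by rewrite half_arc_le//; lia.
Qed.

Lemma arc_inj (R : realType) (m i j : nat) : (i < m)%N -> (j < m)%N ->
  arc R m i = arc R m j -> i = j.
Proof.
move=> im jm e; have m0 : (0 < m)%N by lia.
(* The midpoint of arc [i] lies in no other arc. *)
have : arc R m j (cis (half_arc R m (2 * i).+1)).
  by rewrite -e arcE; eexists => //=; rewrite !half_arc_le//; lia.
by move=> /mem_arc[]; lia.
Qed.

Lemma arcD (R : realType) (m j : nat) : (0 < m)%N ->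
  arc R m (j + m) = arc R m j.
Proof.
move=> m0; have full := half_arc_full R m0.
have e : ((2 * (j + m)).+2 = (2 * j).+2 + 2 * m)%N by lia.
rewrite !arcE e mulnDr (half_arcD _ _ (2 * j)) (half_arcD _ _ (2 * j).+2) full.
apply/seteqP; split => _ [t /= /andP[t1 t2] <-].
- exists (t - 2 * pi); first by apply/andP; split; lra.
  by rewrite -[in RHS](subrK (2 * pi) t) (cisD (t - _)) cis2pi mulr1.
- exists (t + 2 * pi); first by apply/andP; split; lra.
  by rewrite cisD cis2pi mulr1.
Qed.

Lemma arc_modn (R : realType) (m j : nat) : (0 < m)%N ->
  arc R m (j %% m) = arc R m j.
Proof.
move=> m0; rewrite [in RHS](divn_eq j m) addnC.
elim: (j %/ m)%N => [|q IH]; first by rewrite mul0n addn0.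
by rewrite mulSn addnCA addnC arcD.
Qed.

Lemma vertex_arc (R : realType) (m k j : nat) : (k < m)%N -> (j < m)%N ->
  arc R m j (vertex R m k) <-> k = j \/ k = (j.+1 %% m)%N.
Proof.
move=> km jm; have m0 : (0 < m)%N by lia.
rewrite vertexE; split.
  move=> /mem_arc[||/andP[h1 h2]|[h1 h2]]; [lia|done| |].
    have [|h3] := eqVneq k j; [by left|right].
    by rewrite modn_small; lia.
  by right; rewrite h2 modnn; lia.
case=> ->; first by rewrite arcE; eexists => //=; rewrite !half_arc_le//; lia.
rewrite arcE; case: (ltnP j.+1 m) => h.
  by rewrite modn_small//; eexists => //=; rewrite !half_arc_le//; lia.
have -> : j.+1 = m by lia.
rewrite modnn; exists (half_arc R m (2 * m)) => /=.
  by rewrite !half_arc_le//; lia.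
by rewrite half_arc_full// cis2pi /half_arc !mul0r /cis cos0 sin0.
Qed.

(** A shared vertex that starts one arc and ends the other makes them successive; starting both or
    ending both would force [i = j]. *)
Lemma adjacentE (R : realType) (m : nat) (i j : 'I_m) : (2 <= m)%N ->
  adjacent R m i j <->
  (j = i.+1 %% m :> nat)%N \/ (i = j.+1 %% m :> nat)%N.
Proof.
move=> m2; have ne (a : 'I_m) : (a.+1 %% m)%N <> a.
  have := ltn_ord a; rewrite leq_eqVlt => /orP[/eqP e|/modn_small->]; last lia.
  by rewrite e modnn; lia.
split.
  move=> [nij [k [/(vertex_arc R (ltn_ord k) (ltn_ord i)) ki
                  /(vertex_arc R (ltn_ord k) (ltn_ord j)) kj]]].
  case: ki kj => -> [] e; [|by right|by left|].
  - by case: nij; apply: val_inj.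
  - case: nij; apply: val_inj => /=; move: e => /eqP.
    rewrite -[in X in X -> _]addn1 -[j.+1]addn1 eqn_modDr.
    by rewrite !modn_small// => /eqP.
case=> e; split.
- by move=> ij; apply: (ne i); rewrite -e ij.
- exists j; split; apply/vertex_arc => //; [by right|by left].
- by move=> ij; apply: (ne j); rewrite -e ij.
- exists i; split; apply/vertex_arc => //; [by left|by right].
Qed.

Lemma rotation_arc (R : realType) (m k i : nat) : (0 < m)%N ->
  @rotation R (2 * pi * k%:R / m%:R) @` arc R m i = arc R m ((i + k) %% m).
Proof.
move=> m0; rewrite arc_modn// !arcE.
have -> : ((2 * (i + k)).+2 = (2 * i).+2 + 2 * k)%N by lia.
rewrite mulnDr (half_arcD _ _ (2 * i)) (half_arcD _ _ (2 * i).+2).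
have -> : 2 * pi * k%:R / m%:R = half_arc R m (2 * k).
  by rewrite /half_arc natrM; ring.
set K := half_arc R m (2 * k).
apply/seteqP; split => [_ [_ [t /= /andP[t1 t2] <-] <-]|_ [t /= /andP[t1 t2] <-]].
- exists (K + t); last by rewrite cisD.
  by apply/andP; split; lra.
- exists (cis (t - K)); last by rewrite /rotation -cisD; congr cis; ring.
  by exists (t - K) => //=; apply/andP; split; lra.
Qed.

(** The angle [t] goes to [2k] half-arcs minus [t], so the interval from [2i] to [2i + 2] becomes
    the one from [2k - 2i - 2] to [2k - 2i]. The summand [m] keeps the subtraction from truncating
    and costs a full turn [2 * pi] in the angles. *)
Lemma reflection_arc (R : realType) (m k i : nat) : (i < m)%N ->
  @reflection R (pi * k%:R / m%:R) @` arc R m i =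
  arc R m ((k + m - i.+1) %% m).
Proof.
move=> im; have m0 : (0 < m)%N by lia.
rewrite arc_modn// !arcE.
have e1 := half_arcD R m (2 * (k + m - i.+1)) (2 * i).+2.
have e2 := half_arcD R m (2 * (k + m - i.+1)).+2 (2 * i).
have e3 := half_arcD R m (2 * k) (2 * m).
rewrite half_arc_full// in e3.
have h1 : (2 * (k + m - i.+1) + (2 * i).+2 = 2 * k + 2 * m)%N by lia.
have h2 : ((2 * (k + m - i.+1)).+2 + (2 * i) = 2 * k + 2 * m)%N by lia.
rewrite h1 in e1; rewrite h2 in e2.
have -> : pi * k%:R / m%:R = half_arc R m (2 * k) / 2.
  by rewrite /half_arc natrM; field; rewrite pnatr_eq0 -lt0n.
set K := half_arc R m (2 * k) in e3 *.
apply/seteqP; split => [_ [_ [t /= /andP[t1 t2] <-] <-]|_ [t /= /andP[t1 t2] <-]].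
- exists (K - t + 2 * pi); first by apply/andP; split; lra.
  by rewrite reflection_cis cisD cis2pi mulr1; congr cis; field.
- exists (cis (K - t + 2 * pi)).
    by exists (K - t + 2 * pi) => //=; apply/andP; split; lra.
  by rewrite reflection_cis -[LHS]mulr1 -(cis2pi R) -cisD; congr cis; field.
Qed.

(** * The dihedral action on colorings *)

Lemma LambdaP (R : realType) (m : nat) (c : {ffun 'I_m -> 'I_3}) :
  (2 <= m)%N ->
  reflect (forall i j : 'I_m, j = (i.+1 %% m)%N :> nat -> c i != c j)
    (c \in Lambda R m).
Proof.
move=> m2; rewrite inE; apply: (iffP forallP) => [h i j e|h i].
  have /forallP/(_ j)/implyP := h i; apply.
  by apply/asboolP/adjacentE => //; left.
apply/forallP => j; apply/implyP => /asboolP/(adjacentE _ _ _ m2)[] e.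
  exact: h.
by rewrite eq_sym; apply: h.
Qed.

Lemma val_Zp_add1 (n : nat) (i : 'I_n.+2) :
  (i + 1 : 'I_n.+2) = (i.+1 %% n.+2)%N :> nat.
Proof. by rewrite /= addn1. Qed.

Lemma val_Zp_sub (n : nat) (i j : 'I_n.+2) :
  (i - j : 'I_n.+2) = ((i + (n.+2 - j)) %% n.+2)%N :> nat.
Proof. by rewrite /= modnDmr. Qed.

Lemma Lambda_ZpP (R : realType) (n : nat) (c : {ffun 'I_n.+2 -> 'I_3}) :
  reflect (forall i, c i != c (i + 1)) (c \in Lambda R n.+2).
Proof.
apply: (iffP (LambdaP R c isT)) => h i.
  by apply: h; rewrite val_Zp_add1.
move=> j e; have -> : j = i + 1 by exact/val_inj/(etrans e)/esym/val_Zp_add1.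
exact: h.
Qed.

(* [(b, k)] stands for the affine map [i |-> (-1) ^ b * i + k] of Z/(n+2). *)
Definition dih (n : nat) : Type := (bool * 'I_n.+2)%type.

HB.instance Definition _ (n : nat) := Finite.on (dih n).

Definition dih_map (n : nat) (g : dih n) (i : 'I_n.+2) : 'I_n.+2 :=
  (-1) ^+ g.1 * i + g.2.

(** Composition of affine maps with [g] applied first, to fit the convention of right actions. *)
Definition dih_mul (n : nat) (g h : dih n) : dih n :=
  (g.1 (+) h.1, (-1) ^+ h.1 * g.2 + h.2).

Definition dih_one (n : nat) : dih n := (false, 0).

Definition dih_inv (n : nat) (g : dih n) : dih n :=
  (g.1, - ((-1) ^+ g.1 * g.2)).

Lemma dih_mulA (n : nat) : associative (@dih_mul n).
Proof.
move=> [b k] [c l] [d p]; rewrite /dih_mul /= addbA; congr pair.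
by rewrite mulrDr mulrA -signr_addb addrA addbC.
Qed.

Lemma dih_mul1 (n : nat) : left_id (dih_one n) (@dih_mul n).
Proof. by move=> [b k]; rewrite /dih_mul /= mulr0 add0r. Qed.

Lemma dih_mulV (n : nat) : left_inverse (dih_one n) (@dih_inv n) (@dih_mul n).
Proof.
move=> [b k]; rewrite /dih_mul /= addbb mulrN mulrA -signr_addb addbb mul1r.
by rewrite addNr.
Qed.

HB.instance Definition _ (n : nat) :=
  Finite_isGroup.Build (dih n) (@dih_mulA n) (@dih_mul1 n) (@dih_mulV n).

Lemma dih_mapM (n : nat) (g h : dih n) (i : 'I_n.+2) :
  dih_map (g * h)%g i = dih_map h (dih_map g i).
Proof.
rewrite /dih_map /= mulrDr mulrA -signr_addb addrA.
by rewrite addbC.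
Qed.

Lemma dih_map1 (n : nat) (i : 'I_n.+2) : dih_map 1%g i = i.
Proof. by rewrite /dih_map /= mul1r addr0. Qed.

(** The inverse puts on the image of arc [i] the color of arc [i], as in [is_image]. *)
Definition dih_color (n : nat) (c : {ffun 'I_n.+2 -> 'I_3}) (g : dih n) :
  {ffun 'I_n.+2 -> 'I_3} := [ffun i => c (dih_map g^-1%g i)].

Lemma dih_color_is_action (n : nat) :
  is_action [set: dih n]%SET (@dih_color n).
Proof.
apply: is_total_action => [c|c g h]; apply/ffunP => i; rewrite !ffunE.
  by rewrite invg1 dih_map1.
by rewrite invMg dih_mapM.
Qed.

Definition dih_action (n : nat) := Action (@dih_color_is_action n).

Lemma dih_colorP (n : nat) (c c' : {ffun 'I_n.+2 -> 'I_3}) (g : dih n) :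
  (forall i, c' (dih_map g i) = c i) <-> c' = dih_action n c g.
Proof.
split=> [h|-> i]; last by rewrite /= ffunE -dih_mapM mulgV dih_map1.
by apply/ffunP => i; rewrite /= ffunE -h -dih_mapM mulVg dih_map1.
Qed.

Lemma dih_acts_Lambda (R : realType) (n : nat) :
  [acts [set: dih n]%SET, on Lambda R n.+2 | dih_action n].
Proof.
apply/fintype.subsetP => g _; rewrite inE inE /= inE; apply/fintype.subsetP => c.
move=> /Lambda_ZpP hc; rewrite inE; apply/Lambda_ZpP => i.
rewrite /= !ffunE; case: (g^-1)%g => b k; rewrite /dih_map /= mulrDr mulr1.
case: b => /=; last by rewrite mul1r addrAC.
(* A reflection reverses the cyclic order: the image of [i + 1] comes just before that of [i]. *)
rewrite expr1 eq_sym.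
have -> : -1 * i + k = (-1 * i + -1 + k) + 1 by ring.
exact: hc.
Qed.

Lemma rotation_dih (R : realType) (n : nat) (k i : 'I_n.+2) :
  @rotation R (2 * pi * k%:R / n.+2%:R) @` arc R n.+2 i =
  arc R n.+2 (dih_map (false, k) i).
Proof. by rewrite rotation_arc// /dih_map mul1r. Qed.

Lemma reflection_dih (R : realType) (n : nat) (k i : 'I_n.+2) :
  @reflection R (pi * k%:R / n.+2%:R) @` arc R n.+2 i =
  arc R n.+2 (dih_map (true, k - 1) i).
Proof.
rewrite reflection_arc// /dih_map expr1.
have -> : -1 * i + (k - 1) = k - (i + 1) by ring.
congr arc; rewrite val_Zp_sub val_Zp_add1; have := ltn_ord i.
(* For the last arc, [i + 1] wraps around to 0. *)
rewrite leq_eqVlt => /orP[/eqP e|lt].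
  by rewrite e modnn subn0 addnK modnDr.
by rewrite (modn_small lt) addnBA// ltnW.
Qed.

Lemma is_image_dih (R : realType) (n : nat) (G : R[i] -> R[i]) (g : dih n)
    (c c' : {ffun 'I_n.+2 -> 'I_3}) :
  (forall i : 'I_n.+2, G @` arc R n.+2 i = arc R n.+2 (dih_map g i)) ->
  is_image G c c' <-> c' = dih_action n c g.
Proof.
move=> hG; rewrite -dih_colorP; split=> [h i|h i j]; first exact/h/hG.
by rewrite hG => /(arc_inj (ltn_ord _) (ltn_ord _)) /val_inj <-.
Qed.

Lemma dihedral_orbitE (R : realType) (n : nat) (c : {ffun 'I_n.+2 -> 'I_3}) :
  c \in Lambda R n.+2 ->
  dihedral_orbit R n.+2 c = orbit (dih_action n) [set: dih n]%SET c.
Proof.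
move=> hc; apply/setP => c'; rewrite inE; apply/andP/orbitP.
  move=> [_ /asboolP[G [[k ->]|[k ->]]]].
    by move=> /(is_image_dih _ _ (rotation_dih R k)) ->; exists (false, k).
  by move=> /(is_image_dih _ _ (reflection_dih R k)) ->; exists (true, k - 1).
move=> [[b k] _ <-]; split.
   by rewrite (acts_act (dih_acts_Lambda R n) (finset.in_setT _)).
apply/asboolP; case: b.
  (* The reflection of index [k + 1] acts on the arcs as [i |-> k - i]. *)
  pose k1 : 'I_n.+2 := k + 1; exists (@reflection R (pi * k1%:R / n.+2%:R)).
    by right; exists k1.
  by apply/(is_image_dih _ _ (reflection_dih R k1)); rewrite addrK.
exists (@rotation R (2 * pi * k%:R / n.+2%:R)); first by left; exists k.
exact/(is_image_dih _ _ (rotation_dih R k)).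
Qed.

Lemma burnside_orbits (R : realType) (n : nat) :
  (#|orbits R n.+2| * (2 * n.+2) =
   \sum_(k : 'I_n.+2) #|[set c in Lambda R n.+2 | [forall i : 'I_n.+2, c (i + k)%R == c i]]%SET|
   + \sum_(l : 'I_n.+2) #|[set c in Lambda R n.+2 | [forall i : 'I_n.+2, c (l - i)%R == c i]]%SET|)%N.
Proof.
have -> : orbits R n.+2 = (orbit (dih_action n) [set: dih n] @: Lambda R n.+2)%SET.
  by apply: eq_in_imset => c; apply: dihedral_orbitE.
have -> : (2 * n.+2)%N = #|[set: dih n]%SET|.
  by rewrite cardsT /dih card_prod card_bool card_ord.
(* This is Burnside's lemma; the sum over the group is then split by [b] into rotations and
   reflections. *)
rewrite -(Frobenius_Cauchy (dih_acts_Lambda R n)).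
pose fixed (g : dih n) := #|'Fix_(Lambda R n.+2 | dih_action n)[g]%g|.
transitivity (\sum_(b : bool) \sum_(k : 'I_n.+2) fixed (b, k))%N.
  by rewrite pair_bigA; apply: eq_big => [a|[b k] _]; rewrite ?inE.
rewrite big_bool /= addnC; congr addn; apply: eq_bigr => k _.
  apply: eq_card => c; rewrite finset.in_setI [RHS]finset.inE; congr andb.
  apply/afix1P/forallP => [/esym/dih_colorP h i|h].
    by rewrite -(h i) /dih_map mul1r.
  by apply/esym/dih_colorP => i; rewrite /dih_map mul1r; apply/eqP.
apply: eq_card => c; rewrite finset.in_setI [RHS]finset.inE; congr andb.
apply/afix1P/forallP => [/esym/dih_colorP h i|h].
  by rewrite -(h i) /dih_map mulN1r addrC.
by apply/esym/dih_colorP => i; rewrite /dih_map mulN1r addrC; apply/eqP.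
Qed.

(** * Fixed colorings *)

(** By Bezout, the gcd of [n + 2] and [k] is a multiple of [k] in Z/(n+2), so a coloring with period
    [k] also has this gcd as a period. *)
Lemma shift_invariantP (T : eqType) (n : nat) (c : {ffun 'I_n.+2 -> T})
    (k : 'I_n.+2) :
  reflect (forall i j : 'I_n.+2, i = j %[mod gcdn n.+2 k] -> c i = c j)
    [forall i : 'I_n.+2, c (i + k) == c i].
Proof.
apply: (iffP forallP) => [h|h i]; last first.
  apply/eqP/h; rewrite /= modn_dvdm ?dvdn_gcdl//.
  by rewrite -modnDmr (eqP (dvdn_gcdr _ _)) addn0.
have hk a i : c (i + k *+ a) = c i.
  elim: a i => [|a IH] i; first by rewrite addr0.
  by rewrite mulrSr addrA (eqP (h _)) IH.
have [a _ /dvdnP[q e]] := Bezoutl k (isT : (0 < n.+2)%N).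
set d := gcdn n.+2 k in e *.
have dE : d%:R = - (k *+ a) :> 'I_n.+2.
  apply/eqP; rewrite -subr_eq0 opprK -[X in X *+ a](natr_Zp k) -mulrnA -natrD.
  by rewrite [(k * a)%N]mulnC e natrM (@pchar_Zp n.+2)// mulr0.
have hd i : c (i + d%:R) = c i.
  by rewrite dE -(hk a (i - _)) subrK.
have hdq q' i : c (i + (q' * d)%:R) = c i.
  elim: q' i => [|q' IH] i; first by rewrite addr0.
  by rewrite mulSn natrD addrA IH hd.
have wl (i j : 'I_n.+2) : (i <= j)%N -> i = j %[mod d] -> c i = c j.
  move=> ij /eqP; rewrite eq_sym eqn_mod_dvd// => /dvdnP[r er].
  rewrite -(hdq r i) -er natrB// !natr_Zp; congr (c _); ring.
move=> i j e'; have [ij|/ltnW ji] := leqP i j; first exact: wl.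
by apply/esym/wl.
Qed.

(** Since [d] divides [m], reduction mod [d] carries successive arcs to successive arcs, and
    composing with it turns colorings of the [d]-gon into the [d]-periodic ones of the [m]-gon. *)
Lemma card_Lambda_mod (R : realType) (m d : nat) :
  (2 <= d)%N -> (0 < m)%N -> (d %| m)%N ->
  #|[set c in Lambda R m |
      [forall i : 'I_m, forall j : 'I_m, (i == j %[mod d]) ==> (c i == c j)]]%SET|
  = A R d.
Proof.
move=> d2 m0 dm; have d0 : (0 < d)%N by lia.
have led : (d <= m)%N by apply: dvdn_leq.
have m2 : (2 <= m)%N by apply: leq_trans led.
pose red (i : 'I_m) := Ordinal (ltn_pmod i d0).
pose F (c : {ffun 'I_d -> 'I_3}) : {ffun 'I_m -> 'I_3} := [ffun i => c (red i)].
have redK (i : 'I_d) : red (widen_ord led i) = i.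
  by apply: val_inj; rewrite /= modn_small.
have Finj : injective F.
  move=> c c' /ffunP e; apply/ffunP => i.
  by have := e (widen_ord led i); rewrite !ffunE redK.
rewrite /A -(card_imset _ Finj); apply: eq_card => c; rewrite finset.inE.
apply/andP/imsetP => [[/(LambdaP _ _ m2) hc /forallP hd]|[c' /(LambdaP _ _ d2) hc ->]].
  have hd' (i j : 'I_m) : i = j %[mod d] -> c i = c j.
    by move=> /eqP e; apply/eqP; have /forallP/(_ j)/implyP := hd i; apply.
  exists [ffun i => c (widen_ord led i)]; last first.
    by apply/ffunP => i; rewrite !ffunE; apply: hd'; rewrite /= modn_mod.
  apply/(LambdaP _ _ d2) => i j e; rewrite !ffunE.
  (* The successor of [i] in the [m]-gon; it is congruent to [j] mod [d] even when [j] wraps around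
     to 0. *)
  pose j' := Ordinal (ltn_pmod i.+1 m0).
  rewrite (hd' (widen_ord led j) j'); last by rewrite /= e modn_mod modn_dvdm.
  exact: hc.
split.
  apply/(LambdaP _ _ m2) => i j e; rewrite !ffunE; apply: hc => /=.
  by rewrite e modn_dvdm// -[in RHS]addn1 modnDml addn1.
apply/forallP => i; apply/forallP => j; apply/implyP => /eqP e.
by rewrite !ffunE (_ : red i = red j)//; apply: val_inj.
Qed.

Lemma card_Lambda_shift (R : realType) (n : nat) (k : 'I_n.+2) :
  #|[set c in Lambda R n.+2 | [forall i : 'I_n.+2, c (i + k) == c i]]%SET| =
  if (2 <= gcdn n.+2 k)%N then A R (gcdn n.+2 k) else 0%N.
Proof.
case: ifP => [d2|d1].
  rewrite -(card_Lambda_mod R d2 _ (dvdn_gcdl _ _))//.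
  apply: eq_card => c; rewrite !finset.inE; congr andb.
  apply/shift_invariantP/forallP => [h i|h i j /eqP e].
    by apply/forallP => j; apply/implyP => /eqP e; apply/eqP/h.
  by have /forallP/(_ j)/implyP/(_ e)/eqP := h i.
apply: eq_card0 => c; rewrite finset.inE; apply/negP => /andP[/Lambda_ZpP hc].
(* With gcd 1 the coloring is constant, yet the arcs 0 and 1 must differ. *)
move=> /shift_invariantP h; have := hc 0; rewrite (h 0 (0 + 1)) ?eqxx//.
have -> : gcdn n.+2 k = 1%N by have := gcdn_gt0 n.+2 k; lia.
by rewrite !modn1.
Qed.

(** These [k] are the multiples [d * j] with [j < m / d] coprime to [m / d]. *)
Lemma card_gcdn_eq (m d : nat) : (0 < m)%N -> (d %| m)%N ->
  #|[set k : 'I_m | gcdn m k == d]%SET| = totient (m %/ d).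
Proof.
move=> m0 dm; have d0 : (0 < d)%N by apply: dvdn_gt0 dm.
set q := (m %/ d)%N; have mE : m = (d * q)%N by rewrite mulnC divnK.
have lt (j : 'I_q) : (d * j < m)%N by rewrite mE ltn_pmul2l.
pose F (j : 'I_q) := Ordinal (lt j).
have Finj : injective F.
  by move=> i j /(congr1 val) /= /eqP; rewrite eqn_pmul2l// => /eqP /val_inj.
rewrite totient_count_coprime big_mkord -big_mkcond /= sum1_card.
rewrite -(card_imset _ Finj); apply: eq_card => k; rewrite finset.inE.
apply/eqP/imsetP => [e|[j jq ->]].
  have dk : (d %| k)%N by rewrite -e dvdn_gcdr.
  have ltq : (k %/ d < q)%N by rewrite ltn_divLR// mulnC -mE.
  exists (Ordinal ltq); last by apply: val_inj; rewrite /= mulnC divnK.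
  suff : coprime q (k %/ d) by [].
  rewrite /coprime -(eqn_pmul2l d0) muln_gcdr -mE muln1.
  by rewrite [(d * _)%N]mulnC divnK// e.
by rewrite /= [in LHS]mE -muln_gcdr (eqP jq) muln1.
Qed.

(** The indices [k] are grouped by their gcd with [m]; [k = 0] belongs to [d = m]. *)
Lemma sum_gcdn (m : nat) (f : nat -> nat) : (0 < m)%N ->
  (\sum_(k < m) f (gcdn m k) =
   \sum_(0 <= d < m.+1 | d %| m) totient (m %/ d) * f d)%N.
Proof.
move=> m0; have lt (k : 'I_m) : (gcdn m k < m.+1)%N.
  by rewrite ltnS dvdn_leq// dvdn_gcdl.
rewrite big_mkord (partition_big (fun k : 'I_m => Ordinal (lt k))
  (fun d : 'I_m.+1 => d %| m)%N) => [|k _]; last exact: dvdn_gcdl.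
apply: eq_bigr => d dm; rewrite -card_gcdn_eq// -sum1_card big_distrl /=.
apply: eq_big => [k|k /eqP <-]; last by rewrite mul1n.
by rewrite finset.inE -val_eqE.
Qed.

Lemma sum_card_Lambda_shift (R : realType) (n : nat) :
  (\sum_(k : 'I_n.+2)
     #|[set c in Lambda R n.+2 | [forall i : 'I_n.+2, c (i + k)%R == c i]]%SET| =
   \sum_(2 <= d < n.+3 | d %| n.+2) totient (n.+2 %/ d) * A R d)%N.
Proof.
rewrite (eq_bigr _ (fun k _ => card_Lambda_shift R k)).
rewrite (sum_gcdn (fun d => if (2 <= d)%N then A R d else 0%N))//.
rewrite [RHS](big_nat_widenl _ 0)// big_mkcondr /=.
by apply: eq_bigr => d _; case: ifP; rewrite ?muln0.
Qed.

(** * Colorings fixed by a reflection *)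

Lemma card_Lambda_flip_eq0 (R : realType) (n : nat) (l i : 'I_n.+2) :
  l - i = i + 1 ->
  #|[set c in Lambda R n.+2 | [forall i : 'I_n.+2, c (l - i) == c i]]%SET| = 0%N.
Proof.
move=> e; apply: eq_card0 => c; rewrite finset.inE.
apply/negP => /andP[/Lambda_ZpP hc /forallP/(_ i)].
by rewrite e eq_sym (negPf (hc i)).
Qed.

(** With the colors read in Z/3, a nonzero increment is a sign and can be coded by a boolean. *)
Lemma I3_neq0 (z : 'I_3) : z != 0 -> z = (-1) ^+ (z == -1).
Proof. by case: z => -[|[|[|]]] // p _; apply: val_inj. Qed.

Lemma signr_I3_inj (b b' : bool) : (-1) ^+ b = (-1) ^+ b' :> 'I_3 -> b = b'.
Proof. by case: b; case: b' => // /(congr1 val). Qed.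

Lemma val_Zp_opp (n : nat) (i : 'I_n.+2) :
  (0 < i)%N -> (- i : 'I_n.+2) = (n.+2 - i)%N :> nat.
Proof. by move=> i0; rewrite /= modn_small//; lia. Qed.

(* A coloring fixed by a reflection whose axis crosses two arcs is a proper
   coloring of the path formed by the [h.+2] arcs meeting one of the two half
   planes: a color for an end of the path, and a nonzero increment for each of
   the [h.+1] steps. *)
Lemma card_Lambda_flip_double (R : realType) (h : nat) (e : 'I_h.*2.+2) :
  #|[set c in Lambda R h.*2.+2 |
      [forall i : 'I_h.*2.+2, c (e + e - i) == c i]]%SET| = (3 * 2 ^ h.+1)%N.
Proof.
(* Total increment after [t] steps along the path, meaningful for [t <= h.+1]. *)
pose S (b : {ffun 'I_h.+1 -> bool}) (t : nat) : 'I_3 :=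
  \sum_(j < t) (-1) ^+ b (inord j).
have SS b t : S b t.+1 = S b t + (-1) ^+ b (inord t) by rewrite /S big_ord_recr.
(* Cyclic distance from 0; [F] colors an arc according to its distance from the fixed arc [e]. *)
pose r (x : 'I_h.*2.+2) := minn x (h.*2.+2 - x).
pose F (p : 'I_3 * {ffun 'I_h.+1 -> bool}) : {ffun 'I_h.*2.+2 -> 'I_3} :=
  [ffun i => p.1 + S p.2 (r (i - e))].
have rN x : r (- x) = r x.
  rewrite /r /=; have := ltn_ord x; case: (val x) => [|y] ylt.
    by rewrite subn0 modnn.
  by rewrite modn_small; lia.
have rn t : (t <= h.+1)%N -> r t%:R = t.
  by move=> th; rewrite /r Zp_nat /= modn_small; lia.
have Fe p t : (t <= h.+1)%N -> F p (e + t%:R) = p.1 + S p.2 t.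
  by move=> th; rewrite ffunE [e + _]addrC addrK rn.
(* As the number of arcs is even, one step around the circle always changes the distance by exactly
   one. *)
have rS x : exists2 t, (t < h.+1)%N &
    (r x = t /\ r (x + 1) = t.+1) \/ (r x = t.+1 /\ r (x + 1) = t).
  have vx := val_Zp_add1 x; rewrite /r vx; have := ltn_ord x.
  rewrite leq_eqVlt => /orP[/eqP xe|xlt].
    by exists 0%N => //; right; rewrite xe modnn; lia.
  rewrite (modn_small xlt); have [xh|hx] := ltnP x h.+1.
    by exists x => //; left; lia.
  by exists (h.*2.+2 - x.+1)%N; [lia|right; lia].
have Finj : injective F.
  move=> p p' FE; have Ft t : (t <= h.+1)%N -> p.1 + S p.2 t = p'.1 + S p'.2 t.
    by move=> th; rewrite -!Fe// FE.
  have E1 : p.1 = p'.1 by have := Ft 0%N isT; rewrite /S !big_ord0 !addr0.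
  have E2 : p.2 = p'.2.
    apply/ffunP => j; apply: signr_I3_inj.
    have := Ft j.+1 (ltn_ord j); rewrite !SS !inord_val !addrA Ft; last first.
      by rewrite ltnW.
    by move=> /addrI.
  by case: p p' E1 E2 {FE Ft} => a b [a' b'] /= -> ->.
have -> : (3 * 2 ^ h.+1)%N = #|{: 'I_3 * {ffun 'I_h.+1 -> bool}}|.
  by rewrite card_prod card_ffun card_bool !card_ord.
rewrite -(card_codom Finj); apply: eq_card => c; rewrite finset.inE.
apply/andP/codomP => [[/Lambda_ZpP hc /forallP hf]|[p ->]]; last first.
  split.
    apply/Lambda_ZpP => i; rewrite !ffunE addrAC.
    have sg (b : bool) : (-1) ^+ b != 0 :> 'I_3 by case: b.
    have [t tlt] := rS (i - e).
    case=> -[-> ->]; rewrite SS -subr_eq0.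
      by rewrite opprD addrACA subrr add0r opprD addrA subrr add0r oppr_eq0.
    by rewrite opprD addrACA subrr add0r addrAC subrr add0r.
  apply/forallP => i; rewrite !ffunE.
  by rewrite (_ : e + e - i - e = - (i - e)) ?rN//; ring.
(* The preimage of [c] is its color at [e] with the increments read along one half of the circle. *)
pose b : {ffun 'I_h.+1 -> bool} :=
  [ffun j : 'I_h.+1 => c (e + j.+1%:R) - c (e + j%:R) == -1].
exists (c e, b); apply/ffunP => i; rewrite ffunE /=.
have ct t : (t <= h.+1)%N -> c (e + t%:R) = c e + S b t.
  elim: t => [|t IH] th; first by rewrite /S big_ord0 !addr0.
  rewrite SS addrA -IH 1?ltnW// ffunE inordK// -I3_neq0; first by rewrite addrC subrK.
  rewrite subr_eq0 eq_sym -natr1 addrA; exact: hc.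
set x := i - e; have xE : i = e + x by rewrite /x addrC subrK.
have [xh|hx] := leqP x h.+1.
  have <- : (x : nat) = r x by rewrite /r; lia.
  by rewrite -ct// natr_Zp xE.
(* Beyond the half circle, the invariance of [c] brings the arc back to its mirror image. *)
have rx : r x = - x :> nat.
  by rewrite val_Zp_opp ?/r; lia.
rewrite rx -ct; last by rewrite -rx /r; lia.
rewrite natr_Zp -(eqP (hf i)); congr (c _); rewrite /x; ring.
Qed.

(* The axis of the reflection passes through a vertex, so the two arcs at that
   vertex are exchanged. *)
Lemma card_Lambda_flip_odd (R : realType) (n : nat) (l : 'I_n.+2) :
  odd n || odd l ->
  #|[set c in Lambda R n.+2 | [forall i : 'I_n.+2, c (l - i) == c i]]%SET| = 0%N.
Proof.
move=> o; have [i iE] : exists i : 'I_n.+2, i + i + 1 = l.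
  (* An odd representative [2i + 1] of [l] gives arcs [i] and [i + 1] exchanged by the
     reflection. *)
  have half t : odd t -> t%:R = l -> exists i : 'I_n.+2, i + i + 1 = l.
    move=> ot <-; exists t./2%:R; rewrite -natrD addnn natr1.
    by congr _%:R; lia.
  case/orP: o => [on|ol]; last by apply: half ol _; rewrite natr_Zp.
  have [ol|el] := boolP (odd l); first by apply: half ol _; rewrite natr_Zp.
  (* For [l] even and [n] odd, adding the modulus makes the representative odd. *)
  apply: (half (l + n.+2)%N); first by rewrite oddD (negPf el) /= on.
  by rewrite natrD natr_Zp (@pchar_Zp n.+2)// addr0.
apply: (card_Lambda_flip_eq0 _ (i := i)); rewrite -iE; ring.
Qed.

Lemma sum_even_const (h K : nat) :
  (\sum_(0 <= l < h.*2) (if odd l then 0 else K) = h * K)%N.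
Proof.
elim: h => [|h IH]; first by rewrite big_nil.
by rewrite doubleS !big_nat_recr//= IH odd_double addn0 mulSnr.
Qed.

Lemma sum_card_Lambda_flip (R : realType) (n : nat) :
  (\sum_(l : 'I_n.+2)
     #|[set c in Lambda R n.+2 | [forall i : 'I_n.+2, c (l - i)%R == c i]]%SET| =
   if odd n then 0 else n.+2./2 * (3 * 2 ^ n.+2./2))%N.
Proof.
case: ifP => [on|en].
  by apply: big1 => l _; apply: card_Lambda_flip_odd; rewrite on.
have [h ->] : exists h, n = h.*2 by exists n./2; lia.
have -> : h.*2.+2./2 = h.+1 by lia.
rewrite -(sum_even_const h.+1) doubleS big_mkord; apply: eq_bigr => l _.
case: ifP => ol; first by rewrite card_Lambda_flip_odd// ol orbT.
(* For even [l], the arc [l / 2] is fixed by the reflection and serves as [e]. *)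
have -> : l = (l./2)%:R + (l./2)%:R.
  by rewrite -natrD addnn -[LHS]natr_Zp; congr _%:R; lia.
exact: card_Lambda_flip_double.
Qed.

Theorem theorem6p2 (R : realType) (m : nat) (hm : (2 <= m)%N) :
  #|orbits R m|%:R =
    1 / (2 * m%:R) *
    (\sum_(2 <= d < m.+1 | (d %| m)%N) (totient (m %/ d))%:R * (A R d)%:R
     + (1 + (-1) ^+ m) / 2 * 3 * 2 `^ (m%:R / 2) * (m%:R / 2)) :> R.
Proof.
case: m hm => [|[|n]]// _.
have := burnside_orbits R n.
rewrite sum_card_Lambda_shift sum_card_Lambda_flip.
move=> /(congr1 (fun p : nat => p%:R : R)).
rewrite natrM natrD natr_sum [(2 * _)%:R]natrM.
under eq_bigr do rewrite natrM.
set B := \sum_(_ <= _ < _ | _) _; set x : R := n.+2%:R => e.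
have x0 : x != 0 by rewrite pnatr_eq0.
set C := (X in _ = B + X) in e; set C' := (X in _ * (B + X)).
(* The rotation terms already agree, so only the reflection terms are left to compare. *)
suff -> : C' = C by rewrite -e; field.
rewrite /C /C' -signr_odd /= negbK; case: (boolP (odd n)) => [on|en].
  by rewrite expr1 subrr !mul0r.
(* For even [m] the exponent [m / 2] is a natural number, and the real power becomes an ordinary
   one. *)
have xE : x = 2 * (n.+2./2)%:R by rewrite /x -natrM; congr _%:R; lia.
have -> : x / 2 = (n.+2./2)%:R by rewrite xE; field.
by rewrite -[n.+2./2]/(n./2.+1) powR_mulrn// expr0 !natrM natrX; field.
Qed.
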